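(* Let $n\ge2$ and let $S\subset\mathbb{R}^n$ be a nonempty locally closed subset for which there exist collections $\{L_i\}$, $\{L'_j\}$, $\{A_i\}$ forming a Khintchine system for $S$ (defined in the context). Let $\boldsymbol{s}=(s_1,\ldots,s_n)\in(0,1)^n$ with $s_1+\cdots+s_n=1$. Then there exist uncountably many totally irrational $\boldsymbol{\xi}\in S$ such that $\hat{\omega}^*_{\boldsymbol{s}}(\boldsymbol{\xi})=\infty$.
   Context: A set $S\subset\mathbb{R}^n$ is locally closed if there is an open set $\mathcal{W}\subset\mathbb{R}^n$ with $S=\overline{S}\cap\mathcal{W}$. Write $\|\boldsymbol{x}\|=\max_j|x_j|$, $\boldsymbol{x}\cdot\boldsymbol{y}=\sum_j x_jy_j$, and for $x\in\mathbb{R}$ let $\langle x\rangle$ be the distance from $x$ to the nearest integer. For a primitive vector $\mathbf{m}=(m_0,m_1,\ldots,m_n)\in\mathbb{Z}^{n+1}$ with $(m_1,\ldots,m_n)\neq 0$, put $A_{\mathbf{m}}=\{\boldsymbol{\xi}\in\mathbb{R}^n:\sum_{i=1}^n m_i\xi_i=m_0\}$ and $|A_{\mathbf{m}}|=\|(m_1,\ldots,m_n)\|$. The sets $A_{\mathbf{m}}$ are the rational affine hyperplanes. Khintchine system for $S$: disjoint (countable) collections $\{L_1,L_2,\ldots\}$ and $\{L'_1,L'_2,\ldots\}$ of distinct closed subsets of $S$ (closed in $S$), each contained in a rational affine hyperplane, together with, for each $i$, a rational affine hyperplane $A_i\supset L_i$, such that (closures taken in $S$): (a) $\bigcup_i L_i\cup\bigcup_j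 L'_j=\{\boldsymbol{x}\in S:\boldsymbol{x}\text{ is contained in a rational affine hyperplane}\}$; (b) for each $i$ and each $T>0$, $L_i=\overline{\bigcup_{j:\,|A_j|>T}(L_i\cap L_j)}$; (c) for each $i$ and any finite sets of indices $F,F'$ with $i\notin F$, $L_i=\overline{L_i\smallsetminus(\bigcup_{k\in F}L_k\cup\bigcup_{k'\in F'}L'_{k'})}$; (d) $\bigcup_i L_i$ is dense in $S$. A vector $\boldsymbol{\xi}\in\mathbb{R}^n$ is totally irrational if $1,\xi_1,\ldots,\xi_n$ are linearly independent over $\mathbb{Q}$. The $\boldsymbol{s}$-quasinorm is $\|\boldsymbol{x}\|_{\boldsymbol{s}}=\max_{1\le j\le n}|x_j|^{1/s_j}$. The weighted uniform exponent $\hat{\omega}^*_{\boldsymbol{s}}(\boldsymbol{\xi})\in[0,\infty]$ of the linear form $\boldsymbol{\xi}$ is the supremum of those $\gamma$ for which, for all $t$ large enough, there is $\boldsymbol{q}\in\mathbb{Z}^n$ with $\langle\boldsymbol{q}\cdot\boldsymbol{\xi}\rangle\le t^{-\gamma}$ and $0<\|\boldsymbol{q}\|_{\boldsymbol{s}}\le t^n$. *)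

(* Defs.v *)
From HB Require Import structures.
From mathcomp Require Import all_boot all_order all_algebra.
From mathcomp Require Import all_classical all_reals all_analysis.

Set Implicit Arguments.
Unset Strict Implicit.
Unset Printing Implicit Defensive.

Import Order.TTheory GRing.Theory Num.Theory.
Import numFieldNormedType.Exports.

Local Open Scope classical_set_scope.
Local Open Scope ring_scope.

Definition locally_closed (T : topologicalType) (S : set T) : Prop :=
  exists2 W : set T, open W & S = closure S `&` W.

Definition closed_in (T : topologicalType) (S B : set T) : Prop :=
  exists2 C : set T, closed C & B = S `&` C.

(* Only used for [B `<=` S]. *)
Definition closure_in (T : topologicalType) (S B : set T) : set T :=
  S `&` closure B.

(* A vector (m_0, m_1, ..., m_n) is a row indexed by 'I_n.+1: m_0 sits at
   [ord0] and, for i : 'I_n, the coefficient of xi_i sits at [lift ord0 i]. *)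
Definition hyperplane_coefs (n : nat) (m : 'rV[int]_n.+1) : Prop :=
  \big[gcdn/0%N]_(i < n.+1) `|m ord0 i|%N = 1%N
  /\ exists i : 'I_n, m ord0 (lift ord0 i) != 0.

Definition hyperplane (R : realType) (n : nat) (m : 'rV[int]_n.+1) :
    set 'rV[R]_n :=
  [set xi | \sum_(i < n) (m ord0 (lift ord0 i))%:~R * xi ord0 i
            = (m ord0 ord0)%:~R].

Arguments hyperplane R {n} m _.

Definition hyperplane_height (n : nat) (m : 'rV[int]_n.+1) : nat :=
  \max_(i < n) `|m ord0 (lift ord0 i)|%N.

Definition rational_hyperplane (R : realType) (n : nat) (A : set 'rV[R]_n) :
    Prop :=
  exists2 m : 'rV[int]_n.+1, hyperplane_coefs m & A = hyperplane R m.

(* The countable collections are {L i | i in I} and {L' j | j in J}, for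
   arbitrary (possibly finite) sets I, J of natural numbers. The hyperplane A_i
   is given by a primitive vector [m i], which A_i determines up to sign, so
   that |A_i| is [hyperplane_height (m i)]. *)
Record Khintchine_system (R : realType) (n : nat) (S : set 'rV[R]_n)
    (I J : set nat) (L L' : nat -> set 'rV[R]_n) (m : nat -> 'rV[int]_n.+1) :
    Prop := {
  Khintchine_closed : forall i, I i -> closed_in S (L i) ;
  Khintchine_closed' : forall j, J j -> closed_in S (L' j) ;
  Khintchine_inj : set_inj I L ;
  Khintchine_inj' : set_inj J L' ;
  Khintchine_disjoint : forall i j, I i -> J j -> L i <> L' j ;
  Khintchine_coefs : forall i, I i -> hyperplane_coefs (m i) ;
  Khintchine_sub : forall i, I i -> L i `<=` hyperplane R (m i) ;
  Khintchine_sub' : forall j, J j ->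
    exists2 A, rational_hyperplane A & L' j `<=` A ;
  Khintchine_cover :
    \bigcup_(i in I) L i `|` \bigcup_(j in J) L' j
    = [set x | S x /\ exists2 A, rational_hyperplane A & A x] ;
  Khintchine_limit : forall (i : nat) (T : R), I i -> 0 < T ->
    L i = closure_in S
      (\bigcup_(j in [set j | I j /\ T < (hyperplane_height (m j))%:R])
         (L i `&` L j)) ;
  Khintchine_avoid : forall (i : nat) (F F' : set nat), I i ->
    finite_set F -> F `<=` I -> finite_set F' -> F' `<=` J -> ~ F i ->
    L i = closure_in S
      (L i `\` (\bigcup_(k in F) L k `|` \bigcup_(k in F') L' k)) ;
  Khintchine_dense : closure_in S (\bigcup_(i in I) L i) = S
}.

Definition totally_irrational (R : realType) (n : nat) (xi : 'rV[R]_n) : Prop :=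
  forall (c0 : rat) (c : 'rV[rat]_n),
    ratr c0 + \sum_(i < n) ratr (c ord0 i) * xi ord0 i = 0 ->
    c0 = 0 /\ c = 0.

Definition dist_int (R : realType) (x : R) : R :=
  inf [set `|x - k%:~R| | k in [set: int]].

Definition quasinorm (R : realType) (n : nat) (s x : 'rV[R]_n) : R :=
  \big[Num.max/0]_(j < n) (`|x ord0 j| `^ (s ord0 j)^-1).

Definition int_form (R : realType) (n : nat) (q : 'rV[int]_n) (xi : 'rV[R]_n) :
    R :=
  \sum_(j < n) (q ord0 j)%:~R * xi ord0 j.

(* Every [gamma <= 0] is admissible when [0 < n], so that the supremum, taken
   over all real gamma, lies in [0, +oo]. *)
Definition uniform_exponent (R : realType) (n : nat) (s xi : 'rV[R]_n) :
    \bar R :=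
  ereal_sup [set gamma%:E | gamma in [set gamma : R |
    \forall t \near +oo, exists q : 'rV[int]_n,
      dist_int (int_form q xi) <= t `^ (- gamma)
      /\ 0 < quasinorm s (map_mx intr q) <= t ^+ n]].

(* Main.v *)
Require Import Defs.
From HB Require Import structures.
From mathcomp Require Import all_boot all_order all_algebra.
From mathcomp Require Import all_classical all_reals all_analysis.

Set Implicit Arguments.
Unset Strict Implicit.
Unset Printing Implicit Defensive.

Import Order.TTheory GRing.Theory Num.Theory.
Import numFieldNormedType.Exports.

Local Open Scope classical_set_scope.
Local Open Scope ring_scope.

(** The theorem follows Khintchine's construction of singular linear forms.
    One builds a sequence of hyperplane pieces [L i_0], [L i_1], ... and of open
    sets [V_0], [V_1], ... such that [V_k] meets [L i_k] and contains the
    closure of [V_{k+1}].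

    On the piece [L i_k] the linear form with the coefficients of [m i_k] takes
    an integer value [m_0].  Given the pair [(i_k, V_k)], condition (c) yields
    a point of [L i_k] in [V_k] that lies in none of the finitely many pieces to
    be avoided at this stage, and condition (b) then yields near it a point of
    [L i_k] that also lies on some [L j] whose height is as large as desired.
    Setting [i_{k+1} = j], and taking for [V_{k+1}] a small neighbourhood of that
    point, makes the form of [m i_k] as close to [m_0] on [V_{k+1}] as one likes,
    where the required closeness may depend on the already known height of
    [L i_{k+1}] ([exists_child]).

    By compactness some [x] in [S] lies in every [V_k] ([nested_closure_meet]).
    - The coefficients of [m i_k] serve as the integer vector [q] for all [t]
      between the quasinorms (to the power [1/n]) of the [k]-th and of the
      [k+1]-st coefficient vector.  These ranges cover all large [t], hence the
      uniform exponent is infinite ([uniform_exponent_pinfty]).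
    - The point [x] avoids every piece of the system, hence by (a) every
      rational hyperplane, and so it is totally irrational
      ([totally_irrational_avoiding]).
    - The neighbourhoods can be shrunk further so as to avoid, at stage [k], a
      closed set [Z k] disjoint from all the [L i].  As totally irrational points
      lie in no [L i], the sets [Z k] can run through the points of any countable
      set of totally irrational vectors.  So no countable set contains all the
      vectors [x] so constructed. *)

(** * Rational hyperplanes and total irrationality *)

Lemma common_denominator (k : nat) (v : 'I_k -> rat) :
  exists2 D : int, D != 0 &
  exists M : 'I_k -> int, forall i, (M i)%:~R = D%:~R * v i.
Proof.
exists (\prod_(j < k) denq (v j)).
  by apply/prodf_neq0 => j _; exact: denq_neq0.
exists (fun i => numq (v i) * \prod_(j < k | j != i) denq (v j)) => i.
rewrite [in RHS](bigD1 i) //= !intrM mulrAC; congr (_ * _).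
by rewrite mulrC -{2}(divq_num_den (v i)) divfK// intr_eq0 denq_neq0.
Qed.

(** Any integer relation defines a rational hyperplane: dividing its coefficients
    by their gcd makes them primitive. *)
Lemma in_rational_hyperplane (R : realType) (n : nat) (M : 'I_n.+1 -> int)
    (x : 'rV[R]_n) :
  (exists i : 'I_n, M (lift ord0 i) != 0) ->
  \sum_(i < n) (M (lift ord0 i))%:~R * x ord0 i = (M ord0)%:~R ->
  exists2 A, rational_hyperplane A & A x.
Proof.
move=> [i0 Mi0] Mx.
set d := \big[gcdn/0%N]_(i < n.+1) `|M i|%N.
have dM i : (d %| `|M i|)%N.
  by have /dvdn_biggcdP h := dvdnn d; apply: h.
have d0 : (0 < d)%N by rewrite (dvdn_gt0 _ (dM (lift ord0 i0)))// absz_gt0.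
have dR : (d%:Z)%:~R != 0 :> R by rewrite intr_eq0 eqz_nat -lt0n.
pose m : 'rV[int]_n.+1 := \row_i (M i %/ d%:Z)%Z.
have Mm i : M i = m ord0 i * d%:Z by rewrite mxE divzK // dvdzE dM.
exists (hyperplane R m).
  exists m => //; split; last first.
    by exists i0; apply: contraNneq Mi0; rewrite Mm => ->; rewrite mul0r.
  set e := \big[gcdn/0%N]_(i < n.+1) _; apply/eqP.
  rewrite -dvdn1 -(dvdn_pmul2r d0) mul1n.
  apply/dvdn_biggcdP => i _; rewrite Mm abszM dvdn_pmul2r//.
  by have /dvdn_biggcdP h := dvdnn e; apply: h.
apply: (mulIf dR); rewrite -intrM -Mm -Mx mulr_suml.
by apply: eq_bigr => i _; rewrite mulrAC -intrM -Mm.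
Qed.

(** Clearing the denominators of a rational relation between [1] and the
    coordinates of [x] gives an integer relation.  Some coefficient [c_j] is
    nonzero, since a relation that involves [c0] alone forces [c0 = 0]. *)
Lemma totally_irrational_avoiding (R : realType) (n : nat) (x : 'rV[R]_n) :
  (forall A, rational_hyperplane A -> ~ A x) -> totally_irrational x.
Proof.
move=> xA c0 c cx; have c_eq0 : c = 0.
  apply: contrapT => /eqP cN0.
  have [j cj] : exists j, c ord0 j != 0.
    apply/existsP; apply: contraNT cN0 => /existsPn c0'.
    by apply/eqP/rowP => j; rewrite mxE; apply/eqP; rewrite -[_ == _]negbK.
  pose v (i : 'I_n.+1) := if unlift ord0 i is Some j then c ord0 j else - c0.
  have vl (i : 'I_n) : v (lift ord0 i) = c ord0 i by rewrite /v liftK.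
  have v0 : v ord0 = - c0 by rewrite /v unlift_none.
  have [D D0 [M MD]] := common_denominator v.
  have MR i : (M i)%:~R = D%:~R * ratr (v i) :> R.
    by rewrite -[LHS]ratr_int MD rmorphM/= ratr_int.
  have [||A ratA Ax] := @in_rational_hyperplane R n M x.
  - exists j; rewrite -(intr_eq0 rat) MD vl mulf_neq0// intr_eq0//.
  - rewrite MR v0 raddfN/= (addr0_eq cx) mulr_sumr.
    by apply: eq_bigr => i _; rewrite MR vl -mulrA.
  exact: xA ratA Ax.
split=> //; move: cx; rewrite c_eq0 big1 => [|i _]; last first.
  by rewrite mxE raddf0 mul0r.
by rewrite addr0 => /eqP; rewrite fmorph_eq0 => /eqP.
Qed.

Lemma totally_irrational_hyperplane (R : realType) (n : nat)
    (m : 'rV[int]_n.+1) (x : 'rV[R]_n) :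
  hyperplane_coefs m -> totally_irrational x -> ~ hyperplane R m x.
Proof.
move=> [_ [i mi0]] x_irr mx.
have [|_ /rowP/(_ i)] := x_irr (- (m ord0 ord0)%:~R)
    (\row_j (m ord0 (lift ord0 j))%:~R).
  rewrite raddfN/= ratr_int -mx addrC; apply/eqP; rewrite subr_eq0; apply/eqP.
  by apply: eq_bigr => j _; rewrite mxE ratr_int.
by rewrite !mxE => /eqP; rewrite intr_eq0 (negbTE mi0).
Qed.

(** * Linear forms, heights and the uniform exponent *)

Lemma dist_int_le (R : realType) (x : R) (k : int) :
  dist_int x <= `|x - k%:~R|.
Proof.
by apply: ge_inf; [exists 0 => _ [j _ <-]; exact: normr_ge0 | exists k].
Qed.

(** The vector [q k] serves for all [t] with [N k <= t ^+ n < N k.+1].  For such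
    [t >= 1] one has [t <= N k.+1], so an error of at most [N k.+1 ^- k] is at most
    [t `^ (- g)] once [g <= k].  As [N] may fail to be monotone, [k] is
    taken to be the predecessor of the first [l >= K] with [t ^+ n < N l]. *)
Lemma uniform_exponent_pinfty (R : realType) (n : nat) (s x : 'rV[R]_n)
    (q : nat -> 'rV[int]_n) (p : nat -> int) (N : nat -> R) :
  (0 < n)%N ->
  (forall k, N k = quasinorm s (map_mx intr (q k))) ->
  (forall k, 0 < N k) -> (forall k, k%:R <= N k) ->
  (forall k, `|int_form (q k) x - (p k)%:~R| <= (N k.+1 ^+ k)^-1) ->
  uniform_exponent s x = +oo%E.
Proof.
move=> n0 NE N0 Nk small; apply/eqyP => g _.
apply: ereal_sup_ubound; exists g => //=.
pose K := (Num.truncn g).+1.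
have gK : g <= K%:R by apply/ltW/truncnS_gt.
near=> t.
have t1 : 1 <= t by near: t; apply: nbhs_pinfty_ge; rewrite num_real.
have tK : N K <= t by near: t; apply: nbhs_pinfty_ge; rewrite num_real.
have t0 : 0 < t by apply: lt_le_trans t1.
have ttn : t <= t ^+ n by rewrite -[leLHS]expr1 ler_weXn2l.
have exl : exists l, (K <= l)%N && (t ^+ n < N l).
  exists (maxn K (Num.truncn (t ^+ n)).+1); rewrite leq_maxl/=.
  apply: lt_le_trans (Nk _).
  by apply: lt_le_trans (truncnS_gt _) _; rewrite ler_nat leq_maxr.
case: (ex_minnP exl) => -[|k] /andP[Kk tN] kmin; first by move: Kk.
have {}Kk : (K <= k)%N.
  rewrite leq_eqVlt in Kk; case/predU1P: Kk tN => [<-|//].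
  by rewrite ltNge (le_trans tK ttn).
exists (q k); rewrite -NE N0/=; split; last first.
  rewrite leNgt; apply/negP => tNk.
  by have := kmin k; rewrite Kk tNk ltnn => /(_ isT).
apply: le_trans (dist_int_le _ (p k)) _; apply: le_trans (small k) _.
have gk : g <= k%:R by rewrite (le_trans gK)// ler_nat.
apply: (@le_trans _ _ (t `^ (- k%:R))); last by rewrite ler_powR// lerN2.
rewrite powRN powR_mulrn ?(ltW t0)// lef_pV2 ?posrE ?exprn_gt0//.
by rewrite lerXn2r ?nnegrE ?(ltW t0) ?(ltW (N0 _))// (le_trans ttn)// ltW.
Unshelve. all: by end_near. Qed.

Definition form_coefs (n : nat) (m : 'rV[int]_n.+1) : 'rV[int]_n :=
  \row_i m ord0 (lift ord0 i).

Lemma hyperplaneE (R : realType) (n : nat) (m : 'rV[int]_n.+1) (x : 'rV[R]_n) :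
  hyperplane R m x -> int_form (form_coefs m) x = (m ord0 ord0)%:~R.
Proof. by move=> <-; apply: eq_bigr => i _; rewrite mxE. Qed.

Lemma int_form_continuous (R : realType) (n : nat) (q : 'rV[int]_n) :
  continuous (fun x : 'rV[R]_n => int_form q x).
Proof.
rewrite /int_form; elim: (index_enum _) => [|j r IHr] x.
  have -> : (fun y : 'rV[R]_n => \sum_(i <- [::]) (q ord0 i)%:~R * y ord0 i) =
      cst 0 by apply/funext => y; rewrite big_nil.
  exact: cst_continuous.
have -> : (fun y : 'rV[R]_n => \sum_(i <- j :: r) (q ord0 i)%:~R * y ord0 i) =
    fun y => (q ord0 j)%:~R * y ord0 j +
             \sum_(i <- r) (q ord0 i)%:~R * y ord0 i.
  by apply/funext => y; rewrite big_cons.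
apply: cvgD (IHr x); apply: cvgM; first exact: cvg_cst.
exact: coord_continuous.
Qed.

(** A nonzero integer has absolute value at least [1], so raising it to the power
    [1 / s_j >= 1] can only increase it.  Through this bound the heights of
    condition (b) control the quasinorms that the uniform exponent refers to. *)
Lemma height_le_quasinorm (R : realType) (n : nat) (s : 'rV[R]_n)
    (m : 'rV[int]_n.+1) :
  (forall j : 'I_n, 0 < s ord0 j <= 1) ->
  (hyperplane_height m)%:R <= quasinorm s (map_mx intr (form_coefs m)).
Proof.
move=> s01; rewrite /hyperplane_height.
elim/big_ind: _ => [|a b ha hb|i _].
- rewrite /quasinorm; elim/big_ind: _ => // [a b a0 b0|j _].
    by rewrite le_max a0.
  exact: powR_ge0.
- by case: (leqP a b).
apply: le_trans (le_bigmax _ _ i); rewrite !mxE.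
set z := m _ _; have /andP[si0 si1] := s01 i.
rewrite natr_absz; have [->|z0] := eqVneq z 0; first by rewrite powR_ge0.
rewrite -[leLHS]powRr1 ?ler0z// intr_norm ler_powR ?invf_ge1//.
by rewrite -intr_norm (ler_int _ 1) -gtz0_ge1 normr_gt0.
Qed.

Lemma hyperplane_height_gt0 (n : nat) (m : 'rV[int]_n.+1) :
  hyperplane_coefs m -> (0 < hyperplane_height m)%N.
Proof.
move=> [_ [i mi]]; apply: leq_trans (leq_bigmax i).
by rewrite absz_gt0.
Qed.

(** * Two topological lemmas *)

(** The limit point of the construction: a cluster point of any sequence whose
    [k]-th term is chosen in [S `&` V k]. *)
Lemma nested_closure_meet (T : topologicalType) (S : set T) (V : nat -> set T) :
  compact (closure (V 0%N)) -> (forall k, closure (V k.+1) `<=` V k) ->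
  (forall k, S `&` V k !=set0) -> exists2 x, closure S x & forall k, V k x.
Proof.
move=> V0c Vc SV.
have Vle j k : (j <= k)%N -> V k `<=` V j.
  elim: k => [|k IHk]; first by rewrite leqn0 => /eqP ->.
  rewrite leq_eqVlt => /predU1P[->//|jk].
  by apply: subset_trans (IHk jk) => z Vz; apply: Vc; exact: subset_closure.
have [u uP] := choice SV.
have uA (A : set T) : (forall k, A (u k)) -> (u @ \oo) A.
  by move=> Au; exists 0%N => // k _; exact: Au.
have uV0 : (u @ \oo) (closure (V 0%N)).
  apply: uA => k; apply: subset_closure; apply: Vle (leq0n k) _ _.
  by have [] := uP k.
have [x [_ clx]] := V0c _ _ uV0.
exists x => [B xB|k].
  by apply: clx xB; apply: uA => k; have [] := uP k.
apply: Vc => B xB; apply: clx xB.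
apply: filterS (nbhs_infty_gt k) => j kj.
by apply: Vle kj _ _; have [] := uP j.
Qed.

Lemma closed_in_closure (T : topologicalType) (S B : set T) :
  closed_in S B -> S `&` closure B `<=` B.
Proof.
move=> [C C_closed ->] x [Sx clx]; split=> //; apply: C_closed.
by apply: closureS clx => y [].
Qed.

(** * The tree of neighbourhoods *)

Section KhintchineTree.
Context (R : realType) (n : nat) (S : set 'rV[R]_n) (I J : set nat)
  (L L' : nat -> set 'rV[R]_n) (m : nat -> 'rV[int]_n.+1)
  (KS : Khintchine_system S I J L L' m).

(** A continuous upper bound, zero on [L i], for the distance from the [i]-th
    linear form to the nearest integer. *)
Definition form_error (i : nat) (x : 'rV[R]_n) : R :=
  `|int_form (form_coefs (m i)) x - (m i ord0 ord0)%:~R|.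

(** A node [(i, V)] records the current piece and the current neighbourhood; they
    meet, so that conditions (b) and (c) can be applied inside [V]. *)
Definition valid_node (v : nat * set 'rV[R]_n) : Prop :=
  [/\ I v.1, open v.2 & L v.1 `&` v.2 !=set0].

(** One step of the construction.  The tolerance [eps w.1] depends on the piece of
    the child, because the linear form of the parent has to serve until the
    quasinorm of the child is reached.  The piece [L v.1] of the parent is not
    avoided, since the neighbourhood of the child meets it; the growth of the
    heights ensures that later stages do avoid it. *)
Definition child_node (eps : nat -> R) (k : nat) (Z : set 'rV[R]_n)
    (v w : nat * set 'rV[R]_n) : Prop :=
  [/\ valid_node w, closure w.2 `<=` v.2,
      (hyperplane_height (m v.1) + k < hyperplane_height (m w.1))%N &
      forall x, S x -> w.2 x ->
      [/\ forall h, (h <= k)%N -> I h -> h <> v.1 -> ~ L h x,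
          forall h, (h <= k)%N -> J h -> ~ L' h x,
          ~ Z x & form_error v.1 x <= eps w.1]].

Lemma Khintchine_subS (i : nat) : I i -> L i `<=` S.
Proof. by move=> /(Khintchine_closed KS)[C _ ->] x []. Qed.

Lemma form_error_continuous (i : nat) : continuous (form_error i).
Proof.
move=> x; apply: (@continuous_comp _ _ _
  (fun y => int_form (form_coefs (m i)) y - (m i ord0 ord0)%:~R) Num.norm);
  last exact: norm_continuous.
by apply: continuousB; [exact: int_form_continuous | exact: cst_continuous].
Qed.

Lemma form_error_eq0 (i : nat) (x : 'rV[R]_n) :
  I i -> L i x -> form_error i x = 0.
Proof.
move=> Ii Lix; apply/eqP; rewrite normr_eq0 subr_eq0; apply/eqP.
exact/hyperplaneE/(Khintchine_sub KS Ii).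
Qed.

(** Condition (c) provides a point [y] of [L i] off the sets to be avoided, then
    condition (b) a point [z] near [y], on [L i] and on a piece [L j] of large
    height.  As the error of the [i]-th form vanishes at [z], it is small on a
    neighbourhood of [z]; regularity of the space yields a smaller one whose
    closure keeps all these properties. *)
Lemma exists_child (eps : nat -> R) (k : nat) (Z : set 'rV[R]_n)
    (v : nat * set 'rV[R]_n) :
  (forall j, I j -> 0 < eps j) -> closed Z ->
  (forall i x, I i -> L i x -> ~ Z x) ->
  valid_node v -> exists w, child_node eps k Z v w.
Proof.
case: v => i V eps0 Zc LZ [/= Ii oV [x [Lix Vx]]].
pose F := [set h | [/\ (h <= k)%N, I h & h <> i]].
pose F' := [set h | (h <= k)%N /\ J h].
have finF : finite_set F by apply: sub_finite_set (finite_II k.+1) => h [].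
have finF' : finite_set F' by apply: sub_finite_set (finite_II k.+1) => h [].
pose U := \bigcup_(h in F) closure (L h) `|`
          \bigcup_(h in F') closure (L' h) `|` Z.
have oU : open (~` U).
  apply: closed_openC; apply: closedU Zc.
  by apply: closedU; apply: closed_bigcup => // h _; exact: closed_closure.
have [y [[Liy Uy] Vy]] : (L i `\` U) `&` V !=set0.
  have Lav := Khintchine_avoid KS Ii finF _ finF' (F' := F') _ _.
  have := Lix; rewrite {1}Lav; last 3 first.
  - by move=> h [].
  - by move=> h [].
  - by case.
  move=> [_ /(_ _ (open_nbhs_nbhs (conj oV Vx)))[y [[Liy LFy] Vy]]].
  exists y; split=> //; split=> //; have Sy := Khintchine_subS Ii Liy.
  move=> [[[h Fh Ly]|[h Fh Ly]]|Zy]; last exact: LZ Ii Liy Zy.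
  - apply: LFy; left; exists h => //; have [_ Ih _] := Fh.
    exact: closed_in_closure (Khintchine_closed KS Ih) _ (conj Sy Ly).
  - apply: LFy; right; exists h => //; have [_ Jh] := Fh.
    exact: closed_in_closure (Khintchine_closed' KS Jh) _ (conj Sy Ly).
have oVU : open (V `&` ~` U) by exact: openI.
have T0 : 0 < (hyperplane_height (m i) + k)%:R + 1 :> R.
  by rewrite ltr_wpDl.
have := Liy; rewrite (Khintchine_limit KS Ii T0).
move=> [_ /(_ _ (open_nbhs_nbhs (conj oVU (conj Vy Uy))))].
move=> [z [[j [Ij ij] [Liz Ljz]] [Vz Uz]]].
have nz : nbhs z (V `&` ~` U `&` [set t | form_error i t < eps j]).
  apply: filterI; first exact: open_nbhs_nbhs.
  have /(_ [set e | e < eps j]) := form_error_continuous (i := i) (x := z).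
  by rewrite form_error_eq0//; apply; exact: lt_nbhsl (eps0 _ Ij).
have [B zB BV] := uniform_regular nz.
exists (j, B°); split=> /=.
- by split=> //; [exact: open_interior | exists z; split].
- by move=> t /(closureS (@interior_subset _ B))/BV[[]].
- by rewrite -(ltr_nat R) (le_lt_trans _ ij)// lerDl.
move=> t St /interior_subset/subset_closure/BV[[_ Ut] /ltW et]; split=> //.
- move=> h hk Ih hi Lt; apply: Ut; left; left; exists h => //.
  exact: subset_closure.
- move=> h hk Jh Lt; apply: Ut; left; right; exists h => //.
  exact: subset_closure.
- by move=> Zt; apply: Ut; right.
Qed.

(** By condition (d) some piece meets [W]; the bounded neighbourhoods of a common
    point have compact closures. *)
Lemma exists_root (W : set 'rV[R]_n) : S !=set0 -> open W -> S `<=` W ->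
  exists v, [/\ valid_node v, compact (closure v.2) & closure v.2 `<=` W].
Proof.
move=> [x Sx] oW SW; have := Sx; rewrite -(Khintchine_dense KS).
move=> [_ /(_ W (open_nbhs_nbhs (conj oW (SW x Sx))))[y [[i Ii Liy] Wy]]].
have yW : nbhs y (W `&` closed_ball y 1).
  apply: filterI; first exact: open_nbhs_nbhs.
  by apply/nbhs_closedballP; exists 1%:pos.
have [B yB BW] := uniform_regular yW.
have clB : closure B° `<=` W `&` closed_ball y 1.
  by move=> t /(closureS (@interior_subset _ B))/BW.
exists (i, B°); split=> /=.
- by split=> //; [exact: open_interior | exists y; split].
- apply: bounded_closed_compact; last exact: closed_closure.
  exists (`|y| + 1); split; first exact: num_real.
  move=> M yM t /clB[_]; rewrite closed_ballE//= /closed_ball_/= => yt.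
  rewrite (le_trans _ (ltW yM))// -(subrK y t) addrC.
  rewrite (le_trans (ler_normD _ _))//.
  by rewrite lerD2l distrC.
- by move=> t /clB[].
Qed.

(** The sets [Z k] are what makes an uncountability statement possible: they allow
    the constructed point to be kept away from prescribed points. *)
Lemma Khintchine_singular_avoiding (s : 'rV[R]_n) (Z : nat -> set 'rV[R]_n) :
  (0 < n)%N -> S !=set0 -> locally_closed S ->
  (forall j : 'I_n, 0 < s ord0 j <= 1) ->
  (forall k, closed (Z k)) -> (forall k i x, I i -> L i x -> ~ Z k x) ->
  exists x, [/\ S x, totally_irrational x, uniform_exponent s x = +oo%E &
                forall k, ~ Z k x].
Proof.
move=> n0 S0 [W oW SE] s01 Zc LZ.
pose N i := quasinorm s (map_mx intr (form_coefs (m i))).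
have heightN i : (hyperplane_height (m i))%:R <= N i.
  exact: height_le_quasinorm.
have N_gt0 i : I i -> 0 < N i.
  move=> /(Khintchine_coefs KS)/hyperplane_height_gt0 mi.
  by apply: lt_le_trans (heightN i); rewrite ltr0n.
pose eps k i := (N i ^+ k)^-1.
have SW : S `<=` W by rewrite SE => x [].
have [v0 [v0_valid v0c v0W]] := exists_root S0 oW SW.
have [next nextP] : {next : nat * (nat * set 'rV[R]_n) -> nat * set 'rV[R]_n &
    forall kv, valid_node kv.2 ->
      child_node (eps kv.1) kv.1 (Z kv.1) kv.2 (next kv)}.
  apply: (@choice _ _ (fun kv w => valid_node kv.2 ->
    child_node (eps kv.1) kv.1 (Z kv.1) kv.2 w)) => -[k v] /=.
  have [v_valid|v_invalid] := pselect (valid_node v); last by exists v.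
  have [||w vw] := @exists_child (eps k) k (Z k) v _ (Zc k) _ v_valid.
  - by move=> j Ij; rewrite invr_gt0 exprn_gt0// N_gt0.
  - exact: LZ.
  - by exists w.
pose node := nat_rect (fun=> (nat * set 'rV[R]_n)%type) v0
  (fun k v => next (k, v)).
have node_valid k : valid_node (node k).
  by elim: k => [//|k /(nextP (k, node k))[]].
have nodeP k : child_node (eps k) k (Z k) (node k) (node k.+1).
  exact: nextP (k, node k) (node_valid k).
have [||x clSx Vx] := @nested_closure_meet _ S (fun k => (node k).2) v0c.
- by move=> k; have [] := nodeP k.
- move=> k; have [Ik _ [y [Ly Vy]]] := node_valid k.
  by exists y; split=> //; exact: Khintchine_subS Ik _ Ly.
have Sx : S x.
  by rewrite SE; split=> //; apply: v0W; apply: subset_closure; exact: (Vx 0%N).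
have height_lt k : (hyperplane_height (m (node k).1) + k <
    hyperplane_height (m (node k.+1).1))%N by have [] := nodeP k.
have le_height k : (k <= hyperplane_height (m (node k).1))%N.
  case: k => [//|k]; apply: leq_ltn_trans (height_lt k); exact: leq_addl.
have child_avoids k :
  [/\ forall h, (h <= k)%N -> I h -> h <> (node k).1 -> ~ L h x,
    forall h, (h <= k)%N -> J h -> ~ L' h x, ~ Z k x &
    form_error (node k).1 x <= eps k (node k.+1).1].
  by have [_ _ _ kP] := nodeP k; exact: kP Sx (Vx k.+1).
exists x; split=> //; last by move=> k; have [] := child_avoids k.
- apply: totally_irrational_avoiding => A ratA Ax.
  have : [set x | S x /\ exists2 A, rational_hyperplane A & A x] x.
    by split=> //; exists A.
  rewrite -(Khintchine_cover KS) => -[[h Ih Lh]|[h Jh Lh]].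
    (* Stage [h] avoids [L h] unless [L h] is the current piece; the next stage
       then has a piece of larger height, hence another one. *)
    have [hE|hE] := eqVneq h (node h).1.
      have [hx _ _ _] := child_avoids h.+1.
      apply: (hx h (leqnSn h) Ih _ Lh) => hE'; move: (height_lt h).
      by rewrite -hE -hE' ltnNge leq_addr.
    have [hx _ _ _] := child_avoids h.
    by apply: (hx h (leqnn h) Ih _ Lh); apply/eqP.
  by have [_ hx _ _] := child_avoids h; exact: (hx h (leqnn h) Jh Lh).
- apply: (@uniform_exponent_pinfty R n s x (fun k => form_coefs (m (node k).1))
    (fun k => m (node k).1 ord0 ord0) (fun k => N (node k).1)) => // k.
  + by apply: N_gt0; have [] := node_valid k.
  + by apply: le_trans (heightN _); rewrite ler_nat.
  + by have [] := child_avoids k.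
Qed.

End KhintchineTree.

(** * Uncountably many singular vectors *)

Theorem corollary1p4 (R : realType) (n : nat) (S : set 'rV[R]_n)
    (s : 'rV[R]_n) :
  (2 <= n)%N ->
  S !=set0 ->
  locally_closed S ->
  (exists (I J : set nat) (L L' : nat -> set 'rV[R]_n)
     (m : nat -> 'rV[int]_n.+1), Khintchine_system S I J L L' m) ->
  (forall j : 'I_n, 0 < s ord0 j < 1) ->
  \sum_(j < n) s ord0 j = 1 ->
  ~ countable [set xi : 'rV[R]_n |
      [/\ S xi, totally_irrational xi & uniform_exponent s xi = +oo%E]].
Proof.
move=> n2 S0 lcS [I [J [L [L' [m KS]]]]] s01 _.
set E := [set xi | _] => /countable_injP[f f_inj].
(* Each [Z k] has at most one point, and together the [Z k] fill [E]. *)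
pose Z k := [set e | E e /\ f e = k].
have s01' j : 0 < s ord0 j <= 1.
  by have /andP[-> /ltW ->] := s01 j.
have Zc k : closed (Z k).
  have [[e [Ee fe]]|Z0] := pselect (Z k !=set0); last first.
    by rewrite (_ : Z k = set0); [exact: closed0 | apply/nonemptyPn].
  rewrite (_ : Z k = [set e]).
    apply: accessible_closed_set1; apply: hausdorff_accessible.
    exact: norm_hausdorff.
  apply/seteqP; split=> [z [Ez fz]|z ->]; last by split.
  by apply: f_inj; rewrite ?inE// fz.
have LZ k i x : I i -> L i x -> ~ Z k x.
  move=> Ii Lix [[_ x_irr _] _].
  exact: totally_irrational_hyperplane (Khintchine_coefs KS Ii) x_irr
    (Khintchine_sub KS Ii Lix).
have [x [Sx x_irr x_exp xZ]] :=
  Khintchine_singular_avoiding KS (ltnW n2) S0 lcS s01' Zc LZ.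
by apply: (xZ (f x)); split.
Qed.
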